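(* Let $(X,T)$ be a topological dynamical system with a metric $d$. Then $$\overline{\mathrm{mdim}}_{FK}(T,X,d)=\limsup_{\epsilon\to0}\frac{1}{\log\frac1\epsilon}\sup_{x\in X}h_{FK}(x,\epsilon).$$
   Context: A topological dynamical system $(X,T)$ with a metric $d$ is a non-empty compact metric space $(X,d)$ together with a homeomorphism $T:X\to X$. All limits superior take values in $[0,\infty]$. **Feldman–Katok (FK) metric.** For $x,y\in X$, $n\ge 1$, $\delta>0$, an $(n,\delta)$-match of $x$ and $y$ is an order preserving bijection $\pi:D(\pi)\to R(\pi)$ (i.e. $\pi(i)<\pi(j)$ whenever $i<j$) with $D(\pi),R(\pi)\subset\{0,1,\dots,n-1\}$ and $d(T^{i}x,T^{\pi(i)}y)<\delta$ for every $i\in D(\pi)$. Let $|\pi|$ be the cardinality of $D(\pi)$, and set $$\bar f_{n,\delta}(x,y)=1-\tfrac1n\max\{|\pi|:\pi\text{ is an }(n,\delta)\text{-match of }x\text{ and }y\},\qquad d_{FK_n}(x,y)=\inf\{\delta>0:\bar f_{n,\delta}(x,y)<\delta\}.$$ For a non-empty subset $Z\subset X$, let $r_{FK}(T,Z,n,d,\epsilon)$ be the smallest cardinality of a set $E\subset X$ such that for every $x\in Z$ there is $y\in E$ with $d_{FK_n}(x,y)<\epsilon$, and put $$r_{FK}(T,Z,d,\epsilon)=\limsup_{n\to\infty}\frac1n\log r_{FK}(T,Z,n,d,\epsilon).$$ **FK upper metric mean dimension.** $\displaystyle\overline{\mathrm{mdim}}_{FK}(T,X,d)=\limsup_{\epsilon\to0}\frac{r_{FK}(T,X,d,\epsilon)}{\log\frac1\epsilon}.$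 **FK local $\epsilon$-entropy function.** For $\epsilon>0$ and $x\in X$, $$h_{FK}(x,\epsilon)=\inf\{r_{FK}(T,K,d,\epsilon):K\text{ is a closed neighborhood of }x\}.$$ *)

(* Defs.v *)
From HB Require Import structures.
From mathcomp Require Import all_boot all_order all_algebra finmap.
From mathcomp Require Import all_classical all_reals all_analysis.
Set Implicit Arguments.
Unset Strict Implicit.
Unset Printing Implicit Defensive.
Import Order.TTheory GRing.Theory Num.Theory.
Import numFieldNormedType.Exports.
Local Open Scope classical_set_scope.
Local Open Scope ring_scope.

Definition homeomorphism (X : topologicalType) (T : X -> X) : Prop :=
  continuous T /\
  exists S : X -> X, [/\ continuous S, cancel T S & cancel S T].

Section FeldmanKatok.
Context {R : realType} {X : metricType R}.
Implicit Types (T : X -> X) (x y : X) (n : nat) (delta eps : R) (Z : set X).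

(* A match is encoded by its domain [D] and by a total function [p] of which
   only the restriction to [D] is relevant; its range is [p @: D], onto which
   [p] is a bijection because it is strictly increasing on [D]. *)
Definition is_match T n delta x y (D : {set 'I_n}) (p : {ffun 'I_n -> 'I_n}) :=
  [forall i in D, forall j in D, (i < j)%N ==> (p i < p j)%N] &&
  [forall i in D, mdist (iter i T x) (iter (p i) T y) < delta].

Definition max_match T n delta x y : nat :=
  \max_(m : {set 'I_n} * {ffun 'I_n -> 'I_n} | is_match T delta x y m.1 m.2)
    #|m.1|.

Definition fbar T n delta x y : R := 1 - (max_match T n delta x y)%:R / n%:R.

Definition dFK T n x y : R :=
  inf [set delta | 0 < delta /\ fbar T n delta x y < delta].

Definition FK_spanning T Z n eps (E : {fset X}) : Prop :=
  forall x, Z x -> exists2 y, y \in E & dFK T n x y < eps.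

Local Open Scope ereal_scope.

(* The smallest cardinality of a spanning set: the infimum is attained when
   there is a finite spanning set, and is +oo otherwise. *)
Definition rFKn T Z n eps : \bar R :=
  ereal_inf [set (#|` E|%:R)%:E | E in [set E | FK_spanning T Z n eps E]].

Definition rFK T Z eps : \bar R :=
  limn_esup (fun n => (n%:R^-1)%:E * lne (rFKn T Z n eps)).

Definition mdimFK T : \bar R :=
  limf_esup (fun eps : R => ((ln eps^-1)^-1)%:E * rFK T setT eps) 0^'+.

Definition hFK T x eps : \bar R :=
  ereal_inf [set rFK T K eps | K in [set K | closed K /\ nbhs x K]].

End FeldmanKatok.

(* Main.v *)
Require Import Defs.
From HB Require Import structures.
From mathcomp Require Import all_boot all_order all_algebra finmap.
From mathcomp Require Import all_classical all_reals all_analysis.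
Import Order.TTheory GRing.Theory Num.Theory.
Import numFieldNormedType.Exports.
Local Open Scope classical_set_scope.
Local Open Scope ereal_scope.

(** The two functions of [eps] agree pointwise: [rFK T setT eps] is the supremum
    of the local entropies.  Since [rFK T (A `|` B) eps] is at most the maximum
    of [rFK T A eps] and [rFK T B eps], the complements of the sets [A] with
    [rFK T A eps <= c] form a filter.  If the supremum is below [c] while
    [rFK T setT eps] is not at most [c], this filter is proper, and a cluster
    point of it has no closed neighborhood [K] with [rFK T K eps < c]. *)

(** Growth rates may be infinite; testing them against real [d] alone makes [lee_rate] and
    [lte_rate] applicable. *)
Lemma lee_fin_gt (R : realFieldType) (x y : \bar R) :
  (forall d : R, y < d%:E -> x <= d%:E) -> x <= y.
Proof.
case: y => [r| |] h; last 2 first.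
- exact: leey.
- case: x h => [s| |] h //; last by have := h 0%R (ltNyr _).
  by have := h (s - 1)%R (ltNyr _); rewrite lee_fin leNgt ltrBlDr ltrDl ltr01.
by apply/lee_addgt0Pr => e e0; apply: h; rewrite lte_fin ltrDl.
Qed.

Lemma limf_esup_lt_near (X : choiceType) (T : filteredType X) (R : realType)
    (f : T -> \bar R) (F : set_system T) (c : \bar R) : Filter F ->
  limf_esup f F < c -> \forall x \near F, f x < c.
Proof.
move=> FF /ereal_inf_lt[_ [V FV <-] supc]; apply: filterS FV => x Vx.
by apply: le_lt_trans supc; apply: ereal_sup_ubound; exists x.
Qed.

Lemma limf_esup_le_near (X : choiceType) (T : filteredType X) (R : realType)
    (f : T -> \bar R) (F : set_system T) (c : \bar R) :
  (\forall x \near F, f x <= c) -> limf_esup f F <= c.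
Proof.
move=> Fc; apply: ge_ereal_inf; eexists; first by exists [set x | f x <= c].
by apply: ge_ereal_sup => _ [x xc <-].
Qed.

Section growth_rate.
Variables (R : realType) (n : nat) (a : \bar R) (d : R).
Hypotheses (n_gt0 : (0 < n)%N) (a_ge0 : 0 <= a).

(** Exponentiation turns a bound on the rate into one on the count. The values [0] and [+oo] of [a]
    fit in, since [lne] sends them to [-oo] and [+oo]. *)
Lemma lee_rate :
  ((n%:R^-1)%:E * lne a <= d%:E) = (a <= (expR (n%:R * d))%:E).
Proof.
rewrite lee_pdivrMl ?ltr0n// -[LHS]lee_expeR lneK// in_itv/= a_ge0; exact: leey.
Qed.

Lemma lte_rate :
  ((n%:R^-1)%:E * lne a < d%:E) = (a < (expR (n%:R * d))%:E).
Proof.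
rewrite lte_pdivrMl ?ltr0n// -[LHS]lte_expeR lneK// in_itv/= a_ge0; exact: leey.
Qed.

End growth_rate.

Section FeldmanKatok_spanning.
Context {R : realType} {X : metricType R} (T : X -> X) (eps : R).
Implicit Types (A B Z : set X) (n : nat).

Lemma rFKn_ge0 Z n : 0 <= rFKn T Z n eps.
Proof. by apply: le_ereal_inf_tmp => _ [E _ <-]; rewrite lee_fin. Qed.

Lemma le_rFKn A B n : A `<=` B -> rFKn T A n eps <= rFKn T B n eps.
Proof.
move=> AB; apply: ereal_inf_le_tmp => _ [E BE <-]; exists E => // x Ax.
exact/BE/AB.
Qed.

Lemma rFKn_set0 n : rFKn T set0 n eps = 0.
Proof.
apply/eqP; rewrite eq_le rFKn_ge0 andbT; apply: ge_ereal_inf.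
by exists 0 => //; exists fset0; rewrite ?cardfs0.
Qed.

(** The strict bounds extract actual finite spanning sets from the two infima, and the union of
    these spans [A] and [B] together. *)
Lemma rFKn_setU_lt A B n (a b : R) : rFKn T A n eps < a%:E ->
  rFKn T B n eps < b%:E -> rFKn T (A `|` B) n eps <= (a + b)%:E.
Proof.
move=> /ereal_inf_lt[_ [E AE <-] Ea] /ereal_inf_lt[_ [F BF <-] Fb].
apply: ge_ereal_inf; exists (#|` (E `|` F)%fset|%:R)%:E.
  exists (E `|` F)%fset => // x [/AE|/BF] [y yE xy];
    by exists y => //; rewrite in_fsetU yE ?orbT.
rewrite lee_fin (@le_trans _ _ (#|` E| + #|` F|)%:R%R)//.
  by rewrite ler_nat -cardfsUI leq_addr.
by rewrite natrD lerD// ltW// -lte_fin.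
Qed.

Lemma le_rFK A B : A `<=` B -> rFK T A eps <= rFK T B eps.
Proof.
move=> AB; apply: lee_fin_gt => d Bd.
have {}Bd := limf_esup_lt_near _ _ _ _ _ _ eventually_filter Bd.
apply: limf_esup_le_near; near=> n.
have n_gt0 : (0 < n)%N by near: n; exact: nbhs_infty_gt.
rewrite lee_rate ?rFKn_ge0// (le_trans (le_rFKn _ _ n AB))//.
by rewrite -lee_rate ?rFKn_ge0// ltW//; near: n.
Unshelve. all: by end_near. Qed.

(** The count is [0], whose logarithm is [-oo]. This places the whole space in the filter [G] below
    for every real [c], negative ones included. *)
Lemma rFK_set0 : rFK T set0 eps = -oo.
Proof.
apply/eqP; rewrite -leeNy_eq; apply: lee_fin_gt => d _.
apply: limf_esup_le_near; near=> n.
have n_gt0 : (0 < n)%N by near: n; exact: nbhs_infty_gt.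
by rewrite lee_rate ?rFKn_ge0// rFKn_set0 lee_fin expR_ge0.
Unshelve. all: by end_near. Qed.

Lemma rFK_setU A B :
  rFK T (A `|` B) eps <= maxe (rFK T A eps) (rFK T B eps).
Proof.
apply: lee_fin_gt => d; rewrite gt_max => /andP[Ad Bd].
(* Adding two counts below [expR (n * d)] costs at most a factor 2, which the slack [e] absorbs for
   large [n]. *)
apply/lee_addgt0Pr => e e0; apply: limf_esup_le_near.
have {}Ad := limf_esup_lt_near _ _ _ _ _ _ eventually_filter Ad.
have {}Bd := limf_esup_lt_near _ _ _ _ _ _ eventually_filter Bd.
near=> n.
have n_gt0 : (0 < n)%N by near: n; exact: nbhs_infty_gt.
rewrite -EFinD lee_rate ?rFKn_ge0//.
apply: (@le_trans _ _ (expR (n%:R * d) + expR (n%:R * d))%:E).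
  by apply: rFKn_setU_lt; rewrite -lte_rate ?rFKn_ge0//; near: n.
rewrite lee_fin mulrDr expRD -mulr2n -[leLHS]mulr_natr ler_pM2l ?expR_gt0//.
(* What remains is [2 <= expR (n * e)], that is, [ln 2 / e <= n]. *)
rewrite -[leLHS]lnK ?posrE// ler_expR -ler_pdivrMr//.
by near: n; exact: nbhs_infty_ger.
Unshelve. all: by end_near. Qed.

Lemma rFK_setT_sup_hFK : compact [set: X] ->
  rFK T setT eps = ereal_sup [set hFK T x eps | x in [set: X]].
Proof.
move=> X_compact; apply/eqP; rewrite eq_le; apply/andP; split; last first.
  (* The whole space is itself a closed neighborhood of every point. *)
  apply: ge_ereal_sup => _ [x _ <-]; apply: ereal_inf_lbound.
  by exists setT => //; split; [exact: closedT|exact: filterT].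
apply: lee_fin_gt => c supc; rewrite leNgt; apply/negP => Xc.
pose G : set_system X := [set A | rFK T (~` A) eps <= c%:E].
have GF : ProperFilter G.
  (* Properness is exactly the assumption [Xc]. *)
  split; first by rewrite /G/= setC0; apply/negP; rewrite -ltNge.
  split=> [|A B GA GB|A B AB GA]; rewrite /G/=.
  - by rewrite setCT rFK_set0 leNye.
  - by rewrite setCI (le_trans (rFK_setU _ _))// ge_max GA.
  - by apply: le_trans GA; apply: le_rFK; exact: subsetC.
have [x [_ Gx]] := X_compact G GF filterT.
have : hFK T x eps < c%:E.
  by apply: le_lt_trans supc; apply: ereal_sup_ubound; exists x.
move=> /ereal_inf_lt[_ [K [_ Kx] <-] Kc].
(* As [x] is a cluster point of [G], its neighborhood [K] would have to meet its own complement. *)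
have GK : G (~` K) by rewrite /G/= setCK ltW.
by have [y []] := Gx _ _ GK Kx.
Qed.

End FeldmanKatok_spanning.

Theorem theorem1p3 (R : realType) (X : metricType R) (T : X -> X)
    (X_neq0 : [set: X] !=set0) (X_compact : compact [set: X])
    (T_homeo : homeomorphism T) :
  mdimFK T =
  limf_esup (fun eps : R =>
    ((ln eps^-1)^-1)%:E * ereal_sup [set hFK T x eps | x in [set: X]]) 0^'+.
Proof.
rewrite /mdimFK; congr limf_esup; apply/funext => eps.
by rewrite rFK_setT_sup_hFK.
Qed.
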